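(* If there is a Souslin line, then there is a Souslin line that is monotonically countably metacompact, and there is a Souslin line that is not monotonically countably metacompact.
   Context: A LOTS (linearly ordered topological space) is a linearly ordered set equipped with the usual open interval topology of its ordering. A Souslin line is a LOTS that satisfies the countable chain condition but is not separable. For two collections of sets $\mathcal{U}$ and $\mathcal{V}$, write $\mathcal{U} \prec \mathcal{V}$ if for each $U \in \mathcal{U}$ there is some $V \in \mathcal{V}$ with $U \subseteq V$. A space $X$ is monotonically countably metacompact (in the sense of Popvassilev) if there is a function $r$ that associates with each countable open cover $\mathcal{U}$ of $X$ a point-finite collection $r(\mathcal{U})$ of open sets that covers $X$ and satisfies $r(\mathcal{U}) \prec \mathcal{U}$, in such a way that if $\mathcal{U}$ and $\mathcal{V}$ are countable open covers of $X$ with $\mathcal{U} \prec \mathcal{V}$, then $r(\mathcal{U}) \prec r(\mathcal{V})$. (The collection $r(\mathcal{U})$ is not required to be countable.) *)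

(* Defs.v *)
From HB Require Import structures.
From mathcomp Require Import all_boot all_order all_algebra.
From mathcomp Require Import all_classical topology.

Set Implicit Arguments.
Unset Strict Implicit.
Unset Printing Implicit Defensive.

Local Open Scope classical_set_scope.

(* A LOTS is an [orderTopologicalType d]: a total order whose neighborhood
   filters are generated by the open intervals, open rays and the whole space.
   The display [d] is a notational tag without mathematical content. *)

Definition ccc (T : topologicalType) : Prop :=
  forall C : set (set T),
    (forall U, C U -> open U /\ U !=set0) -> trivIset C id -> countable C.

Definition separable (T : topologicalType) : Prop :=
  exists D : set T, countable D /\ dense D.

Definition souslin_line (d : Order.disp_t) (X : orderTopologicalType d) : Prop :=
  ccc X /\ ~ separable X.

Definition refines (T : Type) (U V : set (set T)) : Prop :=
  forall A, U A -> exists2 B, V B & A `<=` B.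

Definition point_finite (T : Type) (V : set (set T)) : Prop :=
  forall x, finite_set [set A | V A /\ A x].

Definition open_cover (T : topologicalType) (U : set (set T)) : Prop :=
  (forall A, U A -> open A) /\ \bigcup_(A in U) A = [set: T].

Definition countable_open_cover (T : topologicalType) (U : set (set T)) : Prop :=
  countable U /\ open_cover U.

(* [r] is a total function on collections of sets, but it is constrained only
   on countable open covers. *)
Definition monotonically_countably_metacompact (T : topologicalType) : Prop :=
  exists r : set (set T) -> set (set T),
    (forall U, countable_open_cover U ->
       [/\ open_cover (r U), point_finite (r U) & refines (r U) U]) /\
    (forall U V, countable_open_cover U -> countable_open_cover V ->
       refines U V -> refines (r U) (r V)).

(* Main.v *)
(* A Souslin line is turned into a Souslin tree [T] of convex open sets,
   maximal for end-extension among the well-founded forests in which a proper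
   subset leaves room on both sides. The maximal chains of [T], ordered
   lexicographically, form a Souslin line [Y] having the cones of [T] as a base;
   as this base is a well-founded forest, the maximal cones contained in some
   member of a cover form a partition, which depends monotonically on the cover.

   Splitting each point [y] of [Y] into a jump [y0 < y1] destroys the property. A
   refinement of the cover cut at [y] has a member containing some [[y1, f y)]
   with [y < f y]. If a countable set [N] without minimum satisfied [n < f m] for
   all [n], [m] in [N], the refinement of the cover cut at all points of [N] would
   not be point-finite. Hence the points of a cone whose image under [f] lies
   above the cone form a nowhere dense set, and a maximal chain of nodes avoiding
   these sets leads to a branch [y] with [f y = y]. *)

Require Import Defs.
From HB Require Import structures.
From mathcomp Require Import all_boot all_order all_algebra.
From mathcomp Require Import all_classical topology.

Set Implicit Arguments.
Unset Strict Implicit.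
Unset Printing Implicit Defensive.

Import Order.TTheory.

Local Open Scope classical_set_scope.
Local Open Scope order_scope.

(** * Noetherian bases and monotone refinements *)

Definition comparable_set (T : Type) (A B : set T) : Prop :=
  A `<=` B \/ B `<=` A.

(** Well-foundedness for reverse inclusion; together with [nested] it makes [B] a forest growing
    downwards. *)
Definition noetherian (T : Type) (B : set (set T)) : Prop :=
  forall K, K `<=` B -> K !=set0 ->
    exists2 M, K M & forall A, K A -> M `<=` A -> A = M.

Definition nested (T : Type) (B : set (set T)) : Prop :=
  forall A A', B A -> B A' -> A `&` A' !=set0 -> comparable_set A A'.

Lemma noetherian_above (T : Type) (B K : set (set T)) (A : set T) :
  noetherian B -> K `<=` B -> K A ->
  exists M, [/\ K M, A `<=` M & forall A', K A' -> M `<=` A' -> A' = M].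
Proof.
move=> noethB KB KA.
have [||M [KM AM] maxM] := noethB [set A' | K A' /\ A `<=` A'].
- by move=> A' [/KB].
- by exists A; split.
- exists M; split=> // A' KA' MA'; apply: maxM => //; split=> //.
  exact: subset_trans MA'.
Qed.

(* The members of [B] that are maximal among those contained in a member of a
   cover [U] form a partition that depends monotonically on [U]. *)
Lemma noetherian_base_mcm (T : topologicalType) (B : set (set T)) :
  (forall A, B A -> open A) -> nested B -> noetherian B ->
  (forall O x, open O -> O x -> exists A, [/\ B A, A x & A `<=` O]) ->
  monotonically_countably_metacompact T.
Proof.
move=> openB nestB noethB baseB.
pose small U := [set A | B A /\ exists2 V, U V & A `<=` V].
pose r U := [set A | small U A /\ forall A', small U A' -> A `<=` A' -> A' = A].
have smallB U : small U `<=` B by move=> A [].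
have small_r U A : small U A -> exists2 M, r U M & A `<=` M.
  move=> /(noetherian_above noethB (@smallB U))[M [sM AM maxM]].
  by exists M.
exists r; split.
- move=> U [_ [openU coverU]]; split.
  + split; first by move=> A [/smallB /openB].
    apply/seteqP; split=> // x _.
    have : [set: T] x by [].
    rewrite -coverU => -[V UV Vx].
    have [A [BA Ax AV]] := baseB _ _ (openU _ UV) Vx.
    have [|M rM AM] := @small_r U A; first by split=> //; exists V.
    by exists M => //; exact: AM.
  + move=> x; have [->|/set0P[A [rA Ax]]] := eqVneq [set A | r U A /\ A x] set0.
      exact: finite_set0.
    apply: (@sub_finite_set _ _ [set A]); last exact: finite_set1.
    move=> A' [rA' A'x]; have [sA maxA] := rA; have [sA' maxA'] := rA'.
    have [|A'A|AA'] := nestB _ _ (smallB _ _ sA') (smallB _ _ sA).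
    * by exists x.
    * by rewrite /= (maxA' A).
    * exact: maxA.
  + by move=> A [[_ [V UV AV]] _]; exists V.
(* A member of [r U] is also [small] for [V], hence lies inside a maximal such set. *)
- move=> U V _ _ UV A [[BA [U' UU' AU']] _].
  have [V' VV' U'V'] := UV _ UU'.
  by apply: small_r; split=> //; exists V' => //; exact: subset_trans U'V'.
Qed.

(** * Order topologies and convex sets *)

Lemma itv_nbhs_noends d (X : orderTopologicalType d) (O : set X) (x : X) :
  (forall y : X, exists a b, a < y < b) -> open O -> O x ->
  exists a b, a < x < b /\ forall y, a < y < b -> O y.
Proof.
move=> noends openO Ox.
have : nbhs x O by exact: open_nbhs_nbhs.
rewrite itv_nbhsE => -[[p q] /= [opq xpq] pqO].
(* These bounds replace an infinite end of the basic interval. *)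
have [a0 [b0 /andP[a0x xb0]]] := noends x.
have subO y : y \in Interval p q -> O y by move=> ypq; exact: pqO.
case: p q opq xpq {pqO} subO => [[] a|[]] [[] b|[]] //= _ + subO;
  rewrite in_itv /= ?andbT => xab.
- by exists a, b; split=> // y yab; exact: subO.
- exists a, b0; split; first by rewrite xab.
  by move=> y /andP[ay _]; apply: subO; rewrite in_itv /= ay.
- exists a0, b; split; first by rewrite a0x.
  by move=> y /andP[_ yb]; apply: subO; rewrite in_itv /= yb.
- by exists a0, b0; split=> [|y _]; [rewrite a0x|apply: subO; rewrite in_itv].
Qed.

Lemma itv_openP d (X : orderTopologicalType d) (O : set X) :
  (forall x, O x -> exists a b, a < x < b /\ forall y, a < y < b -> O y) ->
  open O.
Proof.
move=> itvO; rewrite openE => x /itvO[a [b [axb abO]]].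
have abO' : [set` `]a, b[] `<=` O by move=> y; rewrite /= in_itv; exact: abO.
apply: (filterS abO'); apply: open_nbhs_nbhs; split; first exact: itv_open.
by rewrite /= in_itv.
Qed.

Lemma countable_inj_image (I J : Type) (f : I -> J) (K : set I) :
  {in K &, injective f} -> countable (f @` K) -> countable K.
Proof. by move=> injf; rewrite (eq_countable (inj_card_eq injf)). Qed.

Definition set_lt d (X : porderType d) (A B : set X) : Prop :=
  forall a b, A a -> B b -> a < b.

Definition ord_convex d (X : porderType d) (A : set X) : Prop :=
  forall a b x, A a -> A b -> a < x < b -> A x.

(** The order of one pair decides that of all pairs: [side] varies the point of [A], [side'] that of
    [B], and convexity with disjointness forbids a crossing. *)
Lemma set_lt_total d (X : orderType d) (A B : set X) :
  ord_convex A -> ord_convex B -> A !=set0 -> B !=set0 ->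
  A `&` B = set0 -> set_lt A B \/ set_lt B A.
Proof.
move=> cA cB [a Aa] [b Bb] AB0.
have AB x : A x -> B x -> False by move=> Ax Bx; have : (A `&` B) x by []; rewrite AB0.
have side a' b' a'' : A a' -> B b' -> A a'' -> a' < b' -> a'' < b'.
  move=> Aa' Bb' Aa'' a'b'; case: (ltgtP a'' b') => // [b'a''|eab].
  - by case: (@AB b') => //; apply: (cA a' a'') => //; rewrite a'b'.
  - by case: (@AB b') => //; rewrite -eab.
have side' a' b' b'' : A a' -> B b' -> B b'' -> a' < b' -> a' < b''.
  move=> Aa' Bb' Bb'' a'b'; case: (ltgtP a' b'') => // [b''a'|eab].
  - by case: (@AB a') => //; apply: (cB b'' b') => //; rewrite b''a'.
  - by case: (@AB a') => //; rewrite eab.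
case: (ltgtP a b) => [ab|ba|eab].
- by left=> x y Ax By; apply: (side' _ b) => //; exact: (side a).
- right=> y x By Ax; case: (ltgtP y x) => // [xy|exy].
  + have : a < b by apply: (side x) => //; apply: (side' _ y).
    by move/(lt_trans ba); rewrite ltxx.
  + by case: (@AB x) => //; rewrite -exy.
- by case: (@AB a) => //; rewrite eab.
Qed.

(* A Souslin tree, ordered by reverse inclusion, realized by convex sets; it
   may have several roots. *)
Record souslin_tree d (X : orderType d) (T : set (set X)) : Prop := {
  tree_neq0 : forall A, T A -> A !=set0;
  tree_convex : forall A, T A -> ord_convex A;
  tree_nested : nested T;
  tree_noetherian : noetherian T;
  tree_gap : forall A B, T A -> T B -> B `<` A ->
    exists L R, [/\ T L, T R, L `<=` A, R `<=` A & set_lt L B /\ set_lt B R];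
  tree_nomin : forall A, T A -> exists2 B, T B & B `<` A;
  tree_ccc : forall K, K `<=` T -> trivIset K id -> countable K;
  tree_uncountable : ~ countable T }.

(** * Branches of a Souslin tree and their lexicographic order *)

Definition is_branch (X : Type) (T C : set (set X)) : Prop :=
  [/\ C `<=` T, forall A B, C A -> C B -> comparable_set A B &
      forall A, T A -> (forall B, C B -> comparable_set A B) -> C A].

(** The proof [hT] is a parameter so that the order instances can be attached to the type. *)
Record branch d (X : orderType d) (T : set (set X)) (hT : souslin_tree T) :=
  Branch { nodes : set (set X); nodesP : is_branch T nodes }.

HB.instance Definition _ d (X : orderType d) (T : set (set X))
  (hT : souslin_tree T) := gen_eqMixin (branch hT).
HB.instance Definition _ d (X : orderType d) (T : set (set X))
  (hT : souslin_tree T) := gen_choiceMixin (branch hT).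

Section BranchOrder.
Context d (X : orderType d) (T : set (set X)) (hT : souslin_tree T).
Implicit Types (A B : set X) (C D : branch hT).

Lemma nodes_tree C : nodes C `<=` T.
Proof. by case: (nodesP C). Qed.

Lemma nodes_chain C A B : nodes C A -> nodes C B -> comparable_set A B.
Proof. by case: (nodesP C) => _ + _; exact. Qed.

Lemma nodes_max C A :
  T A -> (forall B, nodes C B -> comparable_set A B) -> nodes C A.
Proof. by case: (nodesP C) => _ _; exact. Qed.

(** A node inside [A] lies in [B], and a node containing [A] meets [B]; so [B] is comparable with
    every node. *)
Lemma nodes_up C A B : nodes C A -> T B -> A `<=` B -> nodes C B.
Proof.
move=> CA TB AB; apply: nodes_max => // A' CA'.
have [a Aa] := tree_neq0 hT (nodes_tree CA).
have [AA'|A'A] := nodes_chain CA CA'.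
- apply: (tree_nested hT) => //; first exact: nodes_tree CA'.
  by exists a; split; [exact: AB|exact: AA'].
- by right; exact: subset_trans A'A AB.
Qed.

Lemma nodes_meet C A B : nodes C A -> nodes C B -> ~ A `&` B = set0.
Proof.
move=> CA CB.
have [a Aa] := tree_neq0 hT (nodes_tree CA).
have [b Bb] := tree_neq0 hT (nodes_tree CB).
have [AB|BA] := nodes_chain CA CB.
- by apply/eqP/set0P; exists a; split=> //; exact: AB.
- by apply/eqP/set0P; exists b; split=> //; exact: BA.
Qed.

Lemma notin_nodes C A : T A -> ~ nodes C A ->
  exists2 B, nodes C B & A `&` B = set0.
Proof.
move=> TA nCA; apply: contrapT => /forall2NP CAB; apply: nCA.
apply: nodes_max => // B CB; apply: (tree_nested hT) => //.
  exact: nodes_tree CB.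
by have [//|/eqP/set0P] := CAB B.
Qed.

Lemma eq_branch C D : nodes C `<=` nodes D -> C = D.
Proof.
case: C D => [C hC] [D hD] /= CD.
have eCD : C = D.
  apply/seteqP; split=> // A DA; case: hC => _ _; apply.
  - by case: hD => + _ _; exact.
  - by move=> B /CD DB; case: hD => _ + _; exact.
by move: hC hD {CD}; rewrite eCD => hC hD; congr Branch; exact: Prop_irrelevance.
Qed.

Lemma tree_set_lt_total A B : T A -> T B -> A `&` B = set0 ->
  set_lt A B \/ set_lt B A.
Proof.
by move=> TA TB; apply: set_lt_total;
  by [apply: (tree_convex hT)|apply: (tree_neq0 hT)].
Qed.

Lemma set_lt_set0 A B : set_lt A B -> A `&` B = set0.
Proof.
move=> AB; apply/seteqP; split=> // x [Ax Bx].
by have := AB _ _ Ax Bx; rewrite ltxx.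
Qed.

(** The lexicographic order: distinct branches contain a pair of disjoint nodes, and these are
    ordered as convex sets. *)
Definition branch_lt C D : bool :=
  `[< exists A B, [/\ nodes C A, nodes D B & set_lt A B] >].

Lemma branch_lt_irr : irreflexive branch_lt.
Proof.
move=> C; apply/negbTE/asboolP => -[A [B [CA CB /set_lt_set0]]].
exact: (nodes_meet CA CB).
Qed.

Lemma branch_lt_trans : transitive branch_lt.
Proof.
move=> D C E /asboolP[A [B [CA DB AB]]] /asboolP[B' [A' [DB' EA' BA']]].
apply/asboolP; exists A, A'; split=> // a a' Aa A'a'.
have [b Bb] := tree_neq0 hT (nodes_tree DB).
have [b' B'b'] := tree_neq0 hT (nodes_tree DB').
have [BB'|B'B] := nodes_chain DB DB'.
- exact: lt_trans (AB _ _ Aa Bb) (BA' _ _ (BB' _ Bb) A'a').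
- exact: lt_trans (AB _ _ Aa (B'B _ B'b')) (BA' _ _ B'b' A'a').
Qed.

HB.instance Definition _ := @Order.Lt_isPOrder.Build d (branch hT)
  branch_lt branch_lt_irr branch_lt_trans.

Lemma branch_ltP C D :
  (C < D) <-> exists A B, [/\ nodes C A, nodes D B & set_lt A B].
Proof. by split=> [/asboolP|?] //; apply/asboolP. Qed.

Lemma neq_branch C D : C <> D ->
  exists A B, [/\ nodes C A, nodes D B & A `&` B = set0].
Proof.
move=> nCD; have : ~ nodes C `<=` nodes D by move/eq_branch.
move=> /existsNP[A /not_implyP[CA nDA]].
by have [B DB AB] := notin_nodes (nodes_tree CA) nDA; exists A, B.
Qed.

Lemma branch_le_total : total (<=%O : rel (branch hT)).
Proof.
move=> C D; rewrite !le_eqVlt; have [//|/eqP/neq_branch] := eqVneq C D.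
move=> [A [B [CA DB /tree_set_lt_total]]].
case=> [||AB|BA]; try by [exact: nodes_tree CA|exact: nodes_tree DB].
- suff -> : C < D by rewrite orbT.
  by apply/branch_ltP; exists A, B.
- suff -> : D < C by rewrite !orbT.
  by apply/branch_ltP; exists B, A.
Qed.

HB.instance Definition _ :=
  @Order.POrder_isTotal.Build d (branch hT) branch_le_total.

End BranchOrder.

(** * The Souslin line of branches *)

Section BranchSpace.
Context d (X : orderType d) (T : set (set X)) (hT : souslin_tree T).
Implicit Types (A B : set X).

Definition branch_line := order_topology (branch hT).
HB.instance Definition _ := OrderTopological.on branch_line.

Implicit Types C D : branch_line.

Definition cone A : set branch_line := [set C : branch_line | nodes C A].

(** Zorn's lemma for chains comparable with [A]: a maximal one contains [A] and is maximal among all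
    chains. *)
Lemma cone_neq0 A : T A -> cone A !=set0.
Proof.
move=> TA.
pose P K := [/\ K `<=` T, forall B B', K B -> K B' -> comparable_set B B' &
  forall B, K B -> comparable_set B A].
have [F FP totF|K [[KT Kchain KA] maxK]] := @Zorn_bigcup _ P.
  split.
  - by move=> B [K FK KB]; have [+ _ _] := FP _ FK; exact.
  - move=> B B' [K FK KB] [K' FK' K'B'].
    have [KK'|K'K] := totF _ _ FK FK'.
    + by have [_ + _] := FP _ FK'; apply => //; exact: KK'.
    + by have [_ + _] := FP _ FK; apply => //; exact: K'K.
  - by move=> B [K FK KB]; have [_ _] := FP _ FK; exact.
have addK B : T B -> (forall B', K B' -> comparable_set B B') ->
    comparable_set B A -> K B.
  move=> TB BK BA; apply: contrapT => nKB.
  apply: (maxK (K `|` [set B])).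
    by split=> [|sub]; [exact: subsetUl|apply: nKB; apply: sub; right].
  split.
  - by move=> B' [/KT//|->].
  - move=> B1 B2 [K1|->] [K2|->]; [exact: Kchain| |exact: BK|by left].
    by have [|] := BK _ K1; [right|left].
  - by move=> B' [/KA//|->].
have KKA : K A.
  by apply: addK => // [B /KA[|]|]; [right|left|left].
have hK : is_branch T K.
  by split=> // B TB BK; apply: addK => //; exact: BK.
by exists (Branch hT hK).
Qed.

Lemma cone_sub A B : T B -> A `<=` B -> cone A `<=` cone B.
Proof. by move=> TB AB C CA; exact: nodes_up AB. Qed.

Lemma cone_meet A B : cone A `&` cone B !=set0 -> comparable_set A B.
Proof. by move=> [C [CA CB]]; exact: (nodes_chain CA CB). Qed.

(** If [A] were the least node of [C], a tree member strictly inside [A] would be comparable with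
    every node and so belong to [C]. *)
Lemma cone_below C A : nodes C A -> exists2 B, nodes C B & B `<` A.
Proof.
move=> CA; apply: contrapT => /forall2NP nB.
have [B TB BA] := tree_nomin hT (nodes_tree CA).
have [|//] := nB B; apply; apply: nodes_max => // A' CA'.
left; apply: (subset_trans BA.1).
have [//|A'A] := nodes_chain CA CA'.
have [//|nA'A] := nB A'; apply: contrapT => nAA'.
exact: nA'A.
Qed.

Lemma cone_itv C A : nodes C A ->
  exists C1 C2, [/\ nodes C1 A, nodes C2 A & C1 < C < C2].
Proof.
move=> CA; have [B CB BA] := cone_below CA.
have TA := nodes_tree CA.
have [L [R [TL TR LA RA [LB BR]]]] := tree_gap hT TA (nodes_tree CB) BA.
have [C1 C1L] := cone_neq0 TL; have [C2 C2R] := cone_neq0 TR.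
exists C1, C2; split; [exact: nodes_up LA|exact: nodes_up RA|].
by apply/andP; split; apply/branch_ltP; [exists L, B|exists B, R].
Qed.

Lemma branch_noends C : exists C1 C2, C1 < C < C2.
Proof.
suff [A CA] : exists A, nodes C A.
  by have [C1 [C2 [_ _ C1C2]]] := cone_itv CA; exists C1, C2.
apply: contrapT => /forallNP nC.
suff [A TA] : T !=set0 by apply: (nC A); apply: nodes_max => // B /nC.
apply/set0P; apply/eqP => T0; apply: (tree_uncountable hT).
by rewrite T0; exact: countable0.
Qed.

Lemma cone_convex A : T A -> ord_convex (cone A).
Proof.
move=> TA C1 C2 C C1A C2A /andP[C1C CC2]; apply: contrapT => nCA.
have [B CB AB0] := notin_nodes TA nCA.
have [AB|BA] := tree_set_lt_total hT TA (nodes_tree CB) AB0.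
- have C2C : C2 < C by apply/branch_ltP; exists A, B.
  by have := lt_trans CC2 C2C; rewrite ltxx.
- have CC1 : C < C1 by apply/branch_ltP; exists B, A.
  by have := lt_trans CC1 C1C; rewrite ltxx.
Qed.

Lemma cone_open A : T A -> open (cone A).
Proof.
move=> TA; apply: itv_openP => C CA.
have [C1 [C2 [C1A C2A C1C2]]] := cone_itv CA.
exists C1, C2; split=> // D; exact: (cone_convex TA C1A C2A).
Qed.

(** Two nodes of [C] separate it from [C1] and from [C2]; the smaller one does both. *)
Lemma cone_base (O : set branch_line) C : open O -> O C ->
  exists2 A, nodes C A & cone A `<=` O.
Proof.
move=> openO OC.
have [C1 [C2 [/andP[C1C CC2] C12O]]] := itv_nbhs_noends branch_noends openO OC.
have [P [Q [C1P CQ PQ]]] := (branch_ltP _ _).1 C1C.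
have [Q' [R [CQ' C2R Q'R]]] := (branch_ltP _ _).1 CC2.
have [QQ'|Q'Q] := nodes_chain CQ CQ'.
- exists Q => // D DQ; apply: C12O; apply/andP; split; apply/branch_ltP.
  + by exists P, Q.
  + by exists Q, R; split=> // q r /QQ'; exact: Q'R.
- exists Q' => // D DQ'; apply: C12O; apply/andP; split; apply/branch_ltP.
  + by exists P, Q'; split=> // p q Pp /Q'Q; exact: PQ.
  + by exists Q', R.
Qed.

Lemma branch_dense_order C D : C < D -> exists E, C < E < D.
Proof.
move=> /branch_ltP[P [Q [CP DQ PQ]]].
have [_ [E [_ EP /andP[_ CE]]]] := cone_itv CP.
by exists E; rewrite CE; apply/branch_ltP; exists P, Q.
Qed.

Lemma branch_line_mcm : monotonically_countably_metacompact branch_line.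
Proof.
apply: (@noetherian_base_mcm _ (cone @` T)).
- by move=> _ [A TA <-]; exact: cone_open.
- move=> _ _ [A TA <-] [B TB <-] /cone_meet[AB|BA].
  + by left; exact: cone_sub.
  + by right; exact: cone_sub.
- move=> K KT [_ /[dup] /KT[A TA <-] KA].
  (* Noetherianity is pulled back to the nodes whose cone is in [K]. *)
  have [||M [TM KM] maxM] := tree_noetherian hT (K := [set B | T B /\ K (cone B)]).
  + by move=> B [].
  + by exists A.
  + exists (cone M) => // _ /[dup] /KT[B TB <-] KB MB.
    have [C CM] := cone_neq0 TM.
    have [|BM|MB'] := @cone_meet B M.
    * by exists C; split=> //; exact: MB.
    * by apply/seteqP; split=> //; exact: cone_sub.
    * by rewrite (maxM B).
- move=> O C openO OC; have [A CA AO] := cone_base openO OC.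
  by exists (cone A); split=> //; exists A => //; exact: nodes_tree CA.
Qed.

(** Each member of the family contains a cone. Nodes chosen for distinct members are disjoint:
    otherwise they are comparable, and a branch through the smaller one lies in both members. *)
Lemma branch_line_ccc : ccc branch_line.
Proof.
move=> K openK trivK.
have /choice[g gP] (U : set branch_line) :
    exists A, K U -> T A /\ cone A `<=` U.
  have [KU|nKU] := pselect (K U); last by exists set0.
  have [openU [C UC]] := openK _ KU.
  have [A CA AU] := cone_base openU UC.
  by exists A => _; split=> //; exact: nodes_tree CA.
have ginj U V : K U -> K V -> g U `<=` g V -> U = V.
  move=> KU KV gUV; have [TU gU] := gP _ KU; have [TV gV] := gP _ KV.
  apply: trivK => //; have [C CU] := cone_neq0 TU.
  by exists C; split; [exact: gU|apply: gV; exact: cone_sub CU].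
apply: (countable_inj_image (f := g)).
  by move=> U V /set_mem KU /set_mem KV gUV; apply: ginj => //; rewrite gUV.
apply: (tree_ccc hT); first by move=> _ [U KU <-]; have [] := gP _ KU.
move=> _ _ [U KU <-] [V KV <-] gUV.
have [gU gV] := ((gP _ KU).1, (gP _ KV).1).
have [/(ginj _ _ KU KV)->//|/(ginj _ _ KV KU)->//] := tree_nested hT gU gV gUV.
Qed.

(** Each node [A] contains a tree member [L] to the left of all later nodes. These [L] are pairwise
    disjoint, so the chain condition of the tree applies. *)
Lemma nodes_countable C : countable (nodes C).
Proof.
have /choice[g gP] A : exists L, nodes C A ->
    [/\ T L, L `<=` A & forall B, nodes C B -> B `<` A -> set_lt L B].
  have [CA|nCA] := pselect (nodes C A); last by exists set0.
  have [B CB BA] := cone_below CA.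
  (* [B'] is the immediate successor of [A] in [C]. *)
  have [||B' [CB' B'A] maxB'] :=
      tree_noetherian hT (K := [set B | nodes C B /\ B `<` A]).
  - by move=> ? [/nodes_tree].
  - by exists B.
  have [L [R [TL _ LA _ [LB' _]]]] :=
    tree_gap hT (nodes_tree CA) (nodes_tree CB') B'A.
  exists L => _; split=> // D CD DA l x Ll Dx; apply: LB' => //.
  have [DB'|B'D] := nodes_chain CD CB'; first exact: DB'.
  by rewrite -(maxB' D).
have ginj A B : nodes C A -> nodes C B -> g A `&` g B !=set0 -> A = B.
  move=> CA CB; have [TA gA ltA] := gP _ CA; have [TB gB ltB] := gP _ CB.
  move=> [x [gAx gBx]]; apply: contrapT => nAB.
  have [AB|BA] := nodes_chain CA CB.
  - have : A `<` B by split=> // BA; apply: nAB; apply/seteqP.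
    by move=> /(ltB _ CA) /(_ x x gBx (gA _ gAx)); rewrite ltxx.
  - have : B `<` A by split=> // AB; apply: nAB; apply/seteqP.
    by move=> /(ltA _ CB) /(_ x x gAx (gB _ gBx)); rewrite ltxx.
apply: (countable_inj_image (f := g)).
  move=> A B /set_mem CA /set_mem CB gAB; apply: ginj => //.
  have [TA _ _] := gP _ CA; have [x gx] := tree_neq0 hT TA.
  by exists x; rewrite -gAB.
apply: (tree_ccc hT); first by move=> _ [U KU <-]; have [] := gP _ KU.
by move=> _ _ [U KU <-] [V KV <-] /ginj->.
Qed.

(** A dense set of branches meets every cone, so a countable one would cover [T] by countably many
    countable chains. *)
Lemma branch_line_nonseparable : ~ separable branch_line.
Proof.
move=> [D [countD denseD]]; apply: (tree_uncountable hT).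
have TD : T `<=` \bigcup_(C in D) nodes C.
  move=> A TA; have [C [CA DC]] := denseD _ (cone_neq0 TA) (cone_open TA).
  by exists C.
apply: (sub_countable (subset_card_le TD)).
by apply: bigcup_countable => // C _; exact: nodes_countable.
Qed.

Lemma branch_line_souslin : souslin_line branch_line.
Proof. by split; [exact: branch_line_ccc|exact: branch_line_nonseparable]. Qed.

End BranchSpace.

(** * Splitting points into jumps *)

Section Doubled.
Context d (Y : orderTopologicalType d).
Hypothesis Y_noends : forall y : Y, exists a b, a < y < b.
Hypothesis Y_dense : forall x y : Y, x < y -> exists z, x < z < y.

(* Every point [y] is split into a jump [(y, false) < (y, true)]. *)
Definition doubled := order_topology (Y *l bool).
HB.instance Definition _ := OrderTopological.on doubled.

Implicit Types (y s : Y) (z : doubled).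

Definition pt y (b : bool) : doubled := (y, b).

Lemma doubled_ltE z z' :
  (z < z') = (z.1 < z'.1) || (z.1 == z'.1) && (~~ z.2 && z'.2).
Proof.
have := @ltEprodlexi _ _ _ _ _ (z : Y *l bool) z'; rewrite /= => ->.
by case: (ltgtP z.1 z'.1) => //= _; case: z.2; case: z'.2.
Qed.

Lemma doubled_noends z : exists p q : doubled, p < z < q.
Proof.
have [a [b /andP[az zb]]] := Y_noends z.1.
by exists (pt a true), (pt b true); rewrite !doubled_ltE /= az zb.
Qed.

(** A point above [(y, true)] has a larger first coordinate, so the right end of an interval around
    it projects to a point beyond [y]. *)
Lemma open_doubled_right (O : set doubled) y : open O -> O (pt y true) ->
  exists2 q, y < q & forall s b, y < s < q -> O (pt s b).
Proof.
move=> openO /(itv_nbhs_noends doubled_noends openO)[p [q [/andP[py yq] pqO]]].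
have yq1 : y < q.1 by move: yq; rewrite doubled_ltE /= andbF orbF.
exists q.1 => // s b /andP[ys sq]; apply: pqO.
by rewrite (lt_trans py) doubled_ltE /= ?ys ?sq.
Qed.

Lemma open_doubled_left (O : set doubled) y : open O -> O (pt y false) ->
  exists2 p, p < y & forall s b, p < s < y -> O (pt s b).
Proof.
move=> openO /(itv_nbhs_noends doubled_noends openO)[p [q [/andP[py yq] pqO]]].
have py1 : p.1 < y by move: py; rewrite doubled_ltE /= !andbF orbF.
exists p.1 => // s b /andP[ps sy]; apply: pqO.
by apply/andP; split; [|apply: lt_trans yq]; rewrite doubled_ltE /= ?ps ?sy.
Qed.

Lemma open_doubled_itv (O : set doubled) : open O -> O !=set0 ->
  exists p q, p < q /\ forall s b, p < s < q -> O (pt s b).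
Proof.
move=> openO [[y []] Oy].
- by have [q yq qO] := open_doubled_right openO Oy; exists y, q.
- by have [p py pO] := open_doubled_left openO Oy; exists p, y.
Qed.

(** A nonempty open set contains both copies of all points of an interval of [Y], so disjoint open
    sets yield disjoint nonempty interiors [h U]. *)
Lemma doubled_ccc : ccc Y -> ccc doubled.
Proof.
move=> cccY K openK trivK.
pose h (U : set doubled) : set Y := interior [set s | forall b, U (pt s b)].
have h_neq0 U : K U -> h U !=set0.
  move=> /openK[openU U0].
  have [p [q [pq pqU]]] := open_doubled_itv openU U0.
  have [s spq] := Y_dense pq; exists s.
  have : nbhs s [set` `]p, q[].
    by apply: open_nbhs_nbhs; split; [exact: itv_open|rewrite /= in_itv].
  by apply: filterS => x; rewrite /= in_itv => xpq b; exact: pqU.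
have hinj U V : K U -> K V -> h U `&` h V !=set0 -> U = V.
  move=> KU KV [y [/interior_subset /(_ true) Uy /interior_subset /(_ true) Vy]].
  by apply: trivK => //; exists (pt y true).
apply: (countable_inj_image (f := h)).
  move=> U V /set_mem KU /set_mem KV hUV; apply: hinj => //.
  by rewrite hUV setIid; exact: h_neq0.
apply: cccY.
- by move=> _ [U KU <-]; split; [exact: open_interior|exact: h_neq0].
- by move=> _ _ [U KU <-] [V KV <-] /(hinj _ _ KU KV)->.
Qed.

Lemma doubled_nonseparable : ~ separable Y -> ~ separable doubled.
Proof.
move=> nsepY [E [countE denseE]]; apply: nsepY.
exists (fst @` E); split; first exact: sub_countable (card_image_le _ _) countE.
move=> O [y Oy] openO.
have [p [q [/andP[py yq] pqO]]] := itv_nbhs_noends Y_noends openO Oy.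
have [||z [/= zpq Ez]] := denseE [set z : doubled | p < z.1 < q].
- by exists (pt y true); rewrite /= py.
(* The strip is the interval from [(p, true)] to [(q, false)]. *)
- apply: itv_openP => z /andP[pz zq].
  exists (pt p true), (pt q false); split=> [|z'].
    by rewrite !doubled_ltE /= pz zq.
  by rewrite !doubled_ltE /= !andbF !orbF.
- by exists z.1; split; [exact: pqO|exists z].
Qed.

Lemma doubled_souslin : souslin_line Y -> souslin_line doubled.
Proof. by move=> [/doubled_ccc ? /doubled_nonseparable]. Qed.

(** The two pieces at [y] are complementary: the jump makes the rays ending at [(y, false)] and
    starting at [(y, true)] both open and closed. *)
Definition cut_cover (N : set Y) : set (set doubled) :=
  \bigcup_(y in N) [set [set z | z < pt y true]; [set z | pt y false < z]].

Lemma cut_coverP N : countable N -> N !=set0 ->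
  countable_open_cover (cut_cover N).
Proof.
move=> countN [y Ny]; split; last split.
- by apply: bigcup_countable => // s _; apply: finite_set_countable; exact: finite_set2.
- move=> _ [s Ns [->|->]].
  + have -> : [set z | z < pt s true] = [set` `]-oo, pt s true[].
      by apply/seteqP; split=> z; rewrite /= in_itv.
    exact: lray_open.
  + have -> : [set z | pt s false < z] = [set` `]pt s false, +oo[].
      by apply/seteqP; split=> z; rewrite /= in_itv /= andbT.
    exact: rray_open.
- apply/seteqP; split=> // z _; have [zy|yz] := ltP z (pt y true).
  + by exists [set z | z < pt y true] => //; exists y => //; left.
  + exists [set z | pt y false < z]; first by exists y => //; right.
    by apply: lt_le_trans yz; rewrite doubled_ltE /= ltxx eqxx.
Qed.

(* The value [f y] is such that some member of the refinement of the two-piece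
   cover cut at [y] contains the interval from [(y, true)] to [f y]. *)
Lemma doubled_mcm_jump : monotonically_countably_metacompact doubled ->
  exists f : Y -> Y, (forall y, y < f y) /\
    forall N : set Y, countable N -> N !=set0 ->
      (forall n, N n -> exists2 m, N m & m < n) ->
      exists n m, [/\ N n, N m & f m <= n].
Proof.
move=> [r [rP rmono]].
have c1 y : countable_open_cover (cut_cover [set y]).
  by apply: cut_coverP; [exact: countable1|exists y].
have /choice[f fP] y : exists q, y < q /\ exists2 V, r (cut_cover [set y]) V &
    forall s, y <= s < q -> V (pt s true).
  have [[openr coverr] _ _] := rP _ (c1 y).
  have : [set: doubled] (pt y true) by [].
  rewrite -coverr => -[V rV Vy].
  have [q yq qV] := open_doubled_right (openr _ rV) Vy.
  exists q; split=> //; exists V => // s; rewrite le_eqVlt andb_orl.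
  by case/orP=> [/andP[/eqP<-]|/qV].
exists f; split=> [y|N countN N0 Nmin]; first by have [] := fP y.
apply: contrapT => Nf.
have {}Nf n m : N n -> N m -> n < f m.
  by move=> Nn Nm; rewrite ltNge; apply/negP => fmn; apply: Nf; exists n, m.
have cN := cut_coverP countN N0.
have [_ pfin refN] := rP _ cN.
have [x0 Nx0] := N0.
have [W_ W_E] := (finite_seqP _).1 (pfin (pt x0 true)).
(* [W_] lists the finitely many members of the refinement at [(x0, true)]. As [N] has no minimum,
   [m] can be taken below the cut for every listed member lying to the right of some cut. *)
have [m [Nm mx0 mP]] : exists m, [/\ N m, m <= x0 &
    forall W, W \in W_ -> forall n, N n -> W `<=` [set z | pt n false < z] ->
      forall m', m' <= m -> ~ W (pt m' true)].
  elim: (W_) => [|W l [m [Nm mx0 ml]]]; first by exists x0.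
  have [[n [Nn Wn]]|nW] := pselect (exists n, N n /\ W `<=` [set z | pt n false < z]).
  - have Nmn : N (Order.min m n) by rewrite /Order.min; case: ifP.
    have [k Nk] := Nmin _ Nmn; rewrite lt_min => /andP[km kn].
    exists k; split=> //; first exact: le_trans (ltW km) mx0.
    have knot m' : m' <= k -> ~ W (pt m' true).
      move=> m'k /Wn; rewrite /= doubled_ltE /= andbT => /orP nm'.
      have m'n := le_lt_trans m'k kn.
      case: nm' => [/(lt_trans m'n)|/eqP nm']; first by rewrite ltxx.
      by move: m'n; rewrite nm' ltxx.
    move=> W'; rewrite in_cons => /orP[/eqP->//|W'l] n' Nn' W'n' m' m'k.
    by apply: (ml _ W'l n') => //; exact: le_trans (ltW km).
  - exists m; split=> // W'; rewrite in_cons => /orP[/eqP-> n Nn Wn|/ml//].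
    by case: nW; exists n.
have [fm [V rV Vm]] := fP m.
(* By monotonicity some [W] of the refinement for [N] contains the interval from [m] to [f m], hence
   all points of [N] from [m] on, and [x0] among them. *)
have [|W rW VW] := rmono _ _ (c1 m) cN _ _ rV;
  first by move=> A [_ -> yA]; exists A => //; exists m.
have WN s : m <= s -> N s -> W (pt s true).
  by move=> ms Ns; apply/VW/Vm; rewrite ms Nf.
have WW : W \in W_.
  have : [set A | r (cut_cover N) A /\ A (pt x0 true)] W by split=> //; exact: WN.
  by rewrite W_E.
(* [W] lies on one side of a cut at some [n]. The left side would force [m < n] and then exclude
   [(n, true)], which is in [W]; the right side contradicts the choice of [m]. *)
have [_ [n Nn [->|->]] Wn] := refN _ rW.
- have mn : m < n.
    by have := Wn _ (WN _ (lexx m) Nm); rewrite /= doubled_ltE /= andbF orbF.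
  by have := Wn _ (WN _ (ltW mn) Nn); rewrite /= ltxx.
- exact: (mP _ WW n Nn Wn m (lexx m) (WN _ (lexx m) Nm)).
Qed.

End Doubled.

(** * Pressing down on the split branch line *)

Section DoubledBranchSpace.
Context d (X : orderType d) (T : set (set X)) (hT : souslin_tree T).
Let Y := branch_line hT.

Lemma cone_left A B : T A -> T B -> B `<` A ->
  exists L, [/\ T L, L `<` A & forall y s : Y, nodes y L -> nodes s B -> y < s].
Proof.
move=> TA TB BA; have [L [R [TL _ LA _ [LB _]]]] := tree_gap hT TA TB BA.
exists L; split=> //; last first.
  by move=> y s yL sB; apply/branch_ltP; exists L, B.
split=> // AL; have [b Bb] := tree_neq0 hT TB.
by have := LB _ _ (AL _ (BA.1 _ Bb)) Bb; rewrite ltxx.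
Qed.

(* [f] jumps over the cone of [A] at the points of [jump A]. Under [Hf] these
   sets are nowhere dense, so a maximal chain of nodes each avoiding the jump
   sets of its predecessors generates a branch [y] with [f y = y]. *)
Lemma branch_pressing_down (f : Y -> Y) : (forall y, y < f y) ->
  exists N : set Y, [/\ countable N, N !=set0,
    forall n, N n -> exists2 m, N m & m < n &
    forall n m, N n -> N m -> n < f m].
Proof.
move=> ltf; apply: contrapT => Hf.
pose jump A := [set y : Y | nodes y A /\ forall s : Y, nodes s A -> s < f y].
have avoid A : T A ->
    exists B, [/\ T B, B `<` A & forall y : Y, nodes y B -> ~ jump A y].
  move=> TA; apply: contrapT => /forallNP nB.
  (* If [avoid] fails at [A], then [jump A] meets every smaller cone. Moving left repeatedly gives a
     decreasing sequence in [jump A]; it stays in the cone of [A], hence below all its values under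
     [f], against [Hf]. *)
  have dense_jump B : T B -> B `<` A -> exists2 y : Y, nodes y B & jump A y.
    move=> TB BA; apply: contrapT => /forall2NP By; apply: (nB B); split=> // y yB.
    by have [] := By y.
  have /choice[h hP] (s : Y) : exists s' : Y, jump A s -> jump A s' /\ s' < s.
    have [As|nAs] := pselect (jump A s); last by exists s.
    have [B sB BA] := cone_below As.1.
    have [L [TL LA LB]] := cone_left TA (nodes_tree sB) BA.
    by have [y yL Ay] := dense_jump _ TL LA; exists y => _; split=> //; exact: LB.
  have [B TB BA] := tree_nomin hT TA; have [s0 _ As0] := dense_jump _ TB BA.
  have Aiter n : jump A (iter n h s0).
    by elim: n => //= n IH; exact: (hP _ IH).1.
  apply: Hf; exists (range (fun n => iter n h s0)); split.
  - exact: sub_countable (card_image_le _ _) (countableP _).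
  - by exists s0; exists 0.
  - by move=> _ [n _ <-]; exists (h (iter n h s0));
      [exists n.+1|exact: (hP _ (Aiter n)).2].
  - by move=> _ _ [n _ <-] [m _ <-]; apply: (Aiter m).2; exact: (Aiter n).1.
pose P K := [/\ K `<=` T, forall B B', K B -> K B' -> comparable_set B B' &
  forall A B, K A -> K B -> B `<` A -> forall y : Y, nodes y B -> ~ jump A y].
have [F FP totF|K [[KT Kchain Kjump] maxK]] := @Zorn_bigcup _ P.
  have two B B' : (\bigcup_(K in F) K) B -> (\bigcup_(K in F) K) B' ->
      exists K, [/\ F K, K B & K B'].
    move=> [K FK KB] [K' FK' K'B'].
    by have [/(_ _ KB)|/(_ _ K'B')] := totF _ _ FK FK'; [exists K'|exists K].
  split.
  - by move=> B [K FK KB]; have [+ _ _] := FP _ FK; exact.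
  - move=> B B' FB /(two _ _ FB)[K [FK KB KB']].
    by have [_ + _] := FP _ FK; exact.
  - move=> A B FA /(two _ _ FA)[K [FK KA KB]].
    by have [_ _] := FP _ FK; exact.
have addK B : T B -> (forall A, K A -> B `<=` A) ->
    (forall A, K A -> B `<` A -> forall y : Y, nodes y B -> ~ jump A y) -> K B.
  move=> TB BK Bjump; apply: contrapT => nKB.
  apply: (maxK (K `|` [set B])).
    by split=> [|sub]; [exact: subsetUl|apply: nKB; apply: sub; right].
  split.
  - by move=> B' [/KT//|->].
  - move=> B1 B2 [K1|->] [K2|->]; [exact: Kchain| | |by left].
    + by right; exact: BK.
    + by left; exact: BK.
  - move=> A A' [KA|->] [KA'|->].
    + exact: Kjump.
    + exact: Bjump.
    + by move=> [_]; case; exact: BK.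
    + by move=> [].
(* If [K] has a least member, [avoid] gives a set to add below it. Otherwise a lower bound [D] can
   itself be added, as below each [A] in [K] there is a smaller member of [K] containing [D] and
   avoiding [jump A]. *)
have nolb D : T D -> ~ forall B, K B -> D `<=` B.
  move=> TD DK.
  have [[A0 [KA0 A0K]]|nmin] :=
      pselect (exists A0, K A0 /\ forall B, K B -> A0 `<=` B).
  - have [B [TB BA0 Bjump]] := avoid _ (KT _ KA0).
    apply: BA0.2; apply: (A0K); apply: addK => // [A KA|A KA BA y yB].
      exact: subset_trans BA0.1 (A0K _ KA).
    have [AA0|nAA0] := pselect (A `<=` A0).
    + have -> : A = A0 by apply/seteqP; split=> //; exact: A0K.
      exact: Bjump yB.
    + apply: (Kjump _ A0) => //; first by split=> //; exact: A0K.
      exact: nodes_up yB (KT _ KA0) BA0.1.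
  - apply: (nmin); exists D; split=> //; apply: addK => // A KA DA y yD.
    apply: contrapT => /contrapT Ay; apply: (nmin); exists A; split=> // B KB.
    apply: contrapT => nAB; have [//|BA] := Kchain _ _ KA KB.
    by apply: (Kjump A B) Ay => //; exact: nodes_up yD (KT _ KB) (DK _ KB).
have lt_lb D : T D -> exists B, K B /\ ~ D `<=` B.
  move=> /nolb nD; apply: contrapT => /forallNP KD; apply: nD => B KB.
  by apply: contrapT => DB; apply: (KD B).
(* The upward closure of [K] is a maximal chain because [K] has no lower bound in [T]. *)
pose C := [set A | T A /\ exists2 B, K B & B `<=` A].
have Cbranch : is_branch T C.
  split=> [A []//| |A TA AC].
  - move=> A A' [TA [B KB BA]] [TA' [B' KB' B'A']].
    apply: (tree_nested hT) => //.
    have [BB'|B'B] := Kchain _ _ KB KB'.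
    + have [b Bb] := tree_neq0 hT (KT _ KB).
      by exists b; split; [exact: BA|apply: B'A'; exact: BB'].
    + have [b Bb] := tree_neq0 hT (KT _ KB').
      by exists b; split; [apply: BA; exact: B'B|exact: B'A'].
  - split=> //; have [B [KB nAB]] := lt_lb _ TA.
    exists B => //; have [||//] := AC B; last by move/nAB.
    by split; [exact: KT|exists B].
pose y : Y := Branch hT Cbranch.
(* A node separating [y] from [f y] contains some [B0] in [K], so by convexity [f y] lies above the
   cone of [B0] and [y] is in [jump B0]. But [y] passes through a smaller member of [K], which
   avoids [jump B0]. *)
have [P0 [Q [yP fyQ PQ]]] := (branch_ltP _ _).1 (ltf y).
have [TP [B0 KB0 B0P]] := yP.
have TB0 := KT _ KB0.
have nfyB0 : ~ nodes (f y) B0.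
  move=> fyB0; apply: (nodes_meet (nodes_up fyB0 TP B0P) fyQ).
  exact: set_lt_set0.
have yK B : K B -> nodes y B by move=> KB; split; [exact: KT|exists B].
have [B [KB nB0B]] := lt_lb _ TB0.
have BB0 : B `<` B0 by split=> //; have [/nB0B|] := Kchain _ _ KB0 KB.
apply: (Kjump _ _ KB0 KB BB0 y (yK _ KB)); split; first exact: yK.
move=> s sB0; rewrite ltNge le_eqVlt; apply/negP => /orP[/eqP fys|fys].
- by apply: nfyB0; rewrite fys.
- by apply/nfyB0/(cone_convex TB0 (yK _ KB0) sB0); rewrite ltf.
Qed.

Lemma doubled_branch_line_not_mcm :
  ~ monotonically_countably_metacompact (doubled Y).
Proof.
move=> /(doubled_mcm_jump (@branch_noends _ _ _ hT))[f [ltf Nf]].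
have [N [countN N0 Nmin Nlt]] := branch_pressing_down ltf.
have [n [m [Nn Nm]]] := Nf N countN N0 Nmin.
by rewrite leNgt Nlt.
Qed.

Lemma doubled_branch_line_souslin : souslin_line (doubled Y).
Proof.
apply: doubled_souslin (branch_line_souslin hT).
- exact: branch_noends.
- exact: branch_dense_order.
Qed.

End DoubledBranchSpace.

(** * A Souslin tree inside a Souslin line *)

Section Forest.
Context d (X : orderTopologicalType d).
Implicit Types (x y : X) (A B J : set X) (F : set (set X)).

Definition isolated : set X := [set x | open [set x]].

(** Regions contain no isolated point and so can be split indefinitely; the isolated points are
    countable under the chain condition and can be put into a dense set. *)
Definition region J : Prop :=
  [/\ open J, J !=set0, ord_convex J & J `<=` ~` closure isolated].

(** This becomes [tree_gap] once every region contains a member of the forest. *)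
Definition gap A B : Prop :=
  exists L R, [/\ region L, region R, L `<=` A, R `<=` A &
    set_lt L B /\ set_lt B R].

Definition forest F : Prop :=
  [/\ F `<=` region, nested F, noetherian F &
      forall A B, F A -> F B -> B `<` A -> gap A B].

(** A new member never contains an old one, which keeps unions of chains noetherian. *)
Definition end_extends F F' : Prop :=
  F `<=` F' /\ forall A B, F A -> F' B -> A `<=` B -> F B.

Lemma forest_bigcup (K : set (set (set X))) : K `<=` forest ->
  (forall F F', K F -> K F' -> end_extends F F' \/ end_extends F' F) ->
  forest (\bigcup_(F in K) F) /\
  forall F, K F -> end_extends F (\bigcup_(F in K) F).
Proof.
move=> KF totK.
have endK F : K F -> end_extends F (\bigcup_(F in K) F).
  move=> KF'; split=> [A FA|A B FA [F' KF'' F'B] AB]; first by exists F.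
  by have [[_]|[F'F _]] := totK _ _ KF' KF''; [move=> h; exact: h AB|exact: F'F].
split=> //.
have two B B' : (\bigcup_(F in K) F) B -> (\bigcup_(F in K) F) B' ->
    exists F, [/\ K F, F B & F B'].
  move=> [F FK FB] [F' FK' F'B'].
  by have [[/(_ _ FB)]|[/(_ _ F'B')]] := totK _ _ FK FK'; [exists F'|exists F].
split.
- by move=> A [F /KF[+ _ _ _]]; exact.
- move=> A B UA /(two _ _ UA)[F [/KF[_ + _ _] FA FB]]; exact.
(* All members of [S] containing [A] already belong to the forest [F] of [A]. *)
- move=> S SF [A SA]; have [F KF' FA] := SF _ SA.
  have [_ _ Fnoeth _] := KF _ KF'.
    have [||M [SM AM] maxM] := Fnoeth [set B | S B /\ A `<=` B].
  + by move=> B [/SF UB AB]; exact: (endK _ KF').2 UB AB.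
  + by exists A; split.
  + exists M => // B SB MB; apply: maxM => //; split=> //; exact: subset_trans MB.
- move=> A B UA /(two _ _ UA)[F [/KF[_ _ _ +] FA FB]]; exact.
Qed.

Lemma forest_max : exists F, forest F /\
  forall F', forest F' -> end_extends F F' -> F' = F.
Proof.
pose R (F F' : {F | forest F}) := `[< end_extends (sval F) (sval F') >].
have [||||[F hF] maxF] := @Zorn {F | forest F} R.
- by move=> F; apply/asboolP; split.
- move=> F1 F2 F3 /asboolP[F12 e12] /asboolP[F23 e23]; apply/asboolP; split.
    exact: subset_trans F23.
  by move=> A B FA FB AB; apply: e12 (AB) => //; apply: e23 AB => //; exact: F12.
- move=> [F hF] [F' hF'] /asboolP[/= FF' _] /asboolP[/= F'F _].
  by apply: eq_exist => /=; apply/seteqP.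
- move=> K totK.
  have [||hU endU] := @forest_bigcup (sval @` K).
  + by move=> _ [F _ <-]; exact: (svalP F).
  + move=> _ _ [F KF <-] [F' KF' <-].
    by have [/asboolP|/asboolP] := totK _ _ KF KF'; [left|right].
  + exists (exist _ _ hU) => F KF; apply/asboolP; apply: endU; exact: imageP.
- exists F; split=> // F' hF' FF'.
  have /maxF[] // : R (exist _ F hF) (exist _ F' hF') by exact/asboolP.
Qed.

Lemma region_itv (O : set X) x : open O -> O x -> ~ closure isolated x ->
  exists2 J, region J & J x /\ J `<=` O.
Proof.
move=> openO Ox nIx.
have : nbhs x (O `&` ~` closure isolated).
  apply: open_nbhs_nbhs; split=> //.
  by apply: openI => //; apply: closed_openC; exact: closed_closure.
rewrite itv_nbhsE => -[i [oi xi] iO].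
exists [set` i]; last by split=> // y /iO[].
case: i oi xi iO => l r oi xi iO.
split; first exact: itv_open_ends_open.
- by exists x.
- move=> a b y /=; rewrite !itv_boundlr => /andP[ia _] /andP[_ bi] /andP[ay yb].
  apply/andP; split; [apply: le_trans ia _|apply: le_trans bi];
  by rewrite bnd_simp ltW.
- by move=> y /iO[].
Qed.

Lemma region_subset J A x : region J -> open A -> ord_convex A -> A `<=` J ->
  A x -> region A.
Proof.
move=> [_ _ _ JI] openA cA AJ Ax; split=> //; first by exists x.
exact: subset_trans JI.
Qed.

Lemma region_lt J y x : region J -> J x -> x < y ->
  region (J `&` [set z | z < y]).
Proof.
move=> rJ Jx xy; have [openJ _ cJ _] := rJ.
apply: (@region_subset J _ x) => //.
- apply: openI => //.
  have -> : [set z | z < y] = [set` `]-oo, y[].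
    by apply/seteqP; split=> z; rewrite /= in_itv.
  exact: lray_open.
- move=> a b z [Ja _] [Jb yb] /andP[az zb]; split; last exact: lt_trans yb.
  by apply: (cJ a b) => //; rewrite az.
Qed.

Lemma region_gt J y x : region J -> J x -> y < x ->
  region (J `&` [set z | y < z]).
Proof.
move=> rJ Jx xy; have [openJ _ cJ _] := rJ.
apply: (@region_subset J _ x) => //.
- apply: openI => //.
  have -> : [set z | y < z] = [set` `]y, +oo[].
    by apply/seteqP; split=> z; rewrite /= in_itv /= andbT.
  exact: rray_open.
- move=> a b z [Ja ya] [Jb _] /andP[az zb]; split; last exact: lt_trans az.
  by apply: (cJ a b) => //; rewrite az.
Qed.

Lemma region_two_points J : region J -> exists x y, [/\ J x, J y & x < y].
Proof.
move=> [openJ [x Jx] _ JI].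
have [y [Jy nxy]] : exists y, J y /\ y <> x.
  apply: contrapT => /forallNP nJ; apply: (JI _ Jx); apply: subset_closure.
  suff JE : J = [set x] by rewrite /isolated /= -JE.
  apply/seteqP; split=> [y Jy|_ ->//]; apply: contrapT => nyx.
  exact: (nJ y).
by case: (ltgtP x y) => // [xy|yx|/esym//]; [exists x, y|exists y, x].
Qed.

Lemma region_split J : region J -> exists J1 J2,
  [/\ region J1, region J2, J1 `<=` J, J2 `<=` J & set_lt J1 J2].
Proof.
move=> rJ; have [a [b [Ja Jb ab]]] := region_two_points rJ.
(* Cutting at [y] leaves [x] on the left and [b] on the right. *)
have [x [y [[Jx _] [Jy yb] xy]]] := region_two_points (region_lt rJ Ja ab).
exists (J `&` [set z | z < y]), (J `&` [set z | y < z]); split.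
- exact: region_lt Jx xy.
- exact: region_gt Jb yb.
- exact: subIsetl.
- exact: subIsetl.
- by move=> u v [_ uy] [_]; exact: lt_trans uy.
Qed.

(* [r] stands for [<] or for [>], so that both ends of [J] are treated at once. *)
Lemma forest_avoid_end (r : X -> X -> Prop) F J :
  (forall x, ~ r x x) -> (forall x y, x = y \/ r x y \/ r y x) ->
  (forall A, ord_convex A -> forall a b x, A a -> A b -> r a x -> r x b -> A x) ->
  (forall A B, gap A B -> exists2 G, region G &
     G `<=` A /\ forall x g, B x -> G g -> r x g) ->
  forest F -> region J ->
  exists2 J', region J' & J' `<=` J /\ forall A, F A ->
    (exists2 a, A a & forall j, J j -> r a j) -> A `&` J' !=set0 -> J' `<=` A.
Proof.
move=> r_irr r_tot r_cvx r_gap [Freg Fnest Fnoeth Fgap] rJ.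
have [_ _ cJ _] := rJ.
(* [M] consists of the members that meet [J] and reach beyond its [r]-initial end. Of two points
   beyond that end the one nearer to [J] lies in both members, so [M] is a chain. Either all of [M]
   contains [J], or some [A0] does not; then [J] is cut down to a least [A0], or to a gap between
   [A0] and its successor [A1] in [M]. *)
pose M := [set A | [/\ F A, A `&` J !=set0 & exists2 a, A a & forall j, J j -> r a j]].
have MF : M `<=` F by move=> A [].
have Mchain A B : M A -> M B -> comparable_set A B.
  move=> [FA [a' [Aa' Ja']] [a Aa aJ]] [FB [b' [Bb' Jb']] [b Bb bJ]].
  have [_ _ cA _] := Freg _ FA; have [_ _ cB _] := Freg _ FB.
  apply: Fnest => //; have [eab|[rab|rba]] := r_tot a b.
  - by exists a; split=> //; rewrite eab.
  - by exists b; split=> //; apply: (r_cvx _ cA a a') => //; exact: bJ.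
  - by exists a; split=> //; apply: (r_cvx _ cB b b') => //; exact: aJ.
have [MJ|] := pselect (forall A, M A -> J `<=` A).
  by exists J => //; split=> // A FA aA AJ; apply: MJ.
move=> /existsNP[A0 /not_implyP[MA0 nJA0]].
have [FA0 [a1 [A0a1 Ja1]] [a0 A0a0 a0J]] := MA0.
have [openA0 _ cA0 _] := Freg _ FA0.
have [A0min|] := pselect (forall A, M A -> A0 `<=` A).
  exists (J `&` A0).
    have [openJ _ _ _] := rJ; apply: (@region_subset J _ a1) => //.
    - exact: openI.
    - by move=> a b x [Ja A0a] [Jb A0b] axb; split; [exact: (cJ a b)|exact: (cA0 a b)].
    - exact: subIsetl.
  split=> [|A FA aA [x [Ax [Jx A0x]]]]; first exact: subIsetl.
  by move=> y [_ A0y]; apply: A0min => //; split=> //; exists x.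
move=> /existsNP[B /not_implyP[MB nA0B]].
have BA0 : B `<` A0 by split=> //; have [/nA0B|] := Mchain _ _ MA0 MB.
have [||A1 [MA1 A10] maxA1] := Fnoeth [set A | M A /\ A `<` A0].
- by move=> ? [/MF].
- by exists B.
have [FA1 [p [A1p Jp]] _] := MA1.
have [G rG [GA0 A1G]] := r_gap _ _ (Fgap _ _ FA0 FA1 A10).
(* If [G] left [J], all of [J] would lie between [a0] and a point of [G], hence in [A0]. *)
have GJ : G `<=` J.
  move=> g Gg; apply: contrapT => nJg; apply: nJA0 => j Jj.
  have rpg := A1G _ _ A1p Gg.
  apply: (r_cvx _ cA0 a0 g) => //; [exact: GA0|exact: a0J|].
  have [ejg|[//|rgj]] := r_tot j g; first by case: nJg; rewrite -ejg.
  by case: nJg; exact: (r_cvx _ cJ p j).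
exists G => //; split=> // A FA aA [x [Ax Gx]].
have MA : M A by split=> //; exists x; split=> //; exact: GJ.
have nA1x : ~ A1 x by move=> /A1G/(_ Gx)/r_irr.
have [A0A|nA0A] := pselect (A0 `<=` A); first exact: subset_trans A0A.
have AA0 : A `<` A0 by split=> //; have [/nA0A|] := Mchain _ _ MA0 MA.
have [AA1|A1A] := Mchain _ _ MA MA1; first by case: nA1x; exact: AA1.
by case: nA1x; rewrite -(maxA1 A).
Qed.

(** If no member of [F] lies in [J], each one meeting [J] sticks out at an end. Shrinking [J] at
    both ends gives [J2] inside every member that meets it, and a region inside [J2] can be added to
    [F]. *)
Lemma forest_pibase F J : forest F ->
  (forall F', forest F' -> end_extends F F' -> F' = F) -> region J ->
  exists2 A, F A & A `<=` J.
Proof.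
move=> hF maxF rJ; apply: contrapT => /forall2NP nF.
have {}nF A : F A -> ~ A `<=` J by move=> FA; have [] := nF A.
have [||||J1 rJ1 [J1J leftJ1]] := @forest_avoid_end (fun x y => x < y) F J _ _ _ _ hF rJ.
- by move=> x; rewrite ltxx.
- by move=> x y; case: (ltgtP x y) => [xy|yx|->]; [right; left|right; right|left].
- by move=> A cA a b x Aa Ab ax xb; apply: (cA a b) => //; rewrite ax.
- by move=> A B [L [R [rL rR LA RA [LB BR]]]]; exists R => //; split=> // x g; exact: BR.
have [||||J2 rJ2 [J2J1 rightJ2]] := @forest_avoid_end (fun x y => y < x) F J1 _ _ _ _ hF rJ1.
- by move=> x; rewrite ltxx.
- by move=> x y; case: (ltgtP x y) => [xy|yx|->]; [right; right|right; left|left].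
- by move=> A cA a b x Aa Ab ax xb; apply: (cA b a) => //; rewrite xb.
- by move=> A B [L [R [rL rR LA RA [LB BR]]]]; exists L => //; split=> // x g Bx Lg; exact: LB.
have J2J := subset_trans J2J1 J1J.
have [Freg Fnest Fnoeth Fgap] := hF.
have sideJ2 A : F A -> A `&` J2 !=set0 -> J2 `<=` A.
  move=> FA [x [Ax J2x]]; have Jx := J2J _ J2x.
  have [_ _ cJ _] := rJ.
  have [a [Aa nJa]] : exists a, A a /\ ~ J a.
    by have /existsNP[a /not_implyP] := nF _ FA; exists a.
  case: (ltgtP a x) => [ax|xa|eax]; last by case: nJa; rewrite eax.
  - apply: (subset_trans J2J1); apply: leftJ1 => //; last first.
      by exists x; split=> //; exact: J2J1.
    exists a => // j Jj; case: (ltgtP a j) => // [ja|eaj].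
    + by case: nJa; apply: (cJ j x) => //; rewrite ja.
    + by case: nJa; rewrite eaj.
  - apply: rightJ2 => //; last by exists x.
    exists a => // j /J1J Jj; case: (ltgtP j a) => // [aj|eaj].
    + by case: nJa; apply: (cJ x j) => //; rewrite xa.
    + by case: nJa; rewrite -eaj.
(* [K3] is the region to be added; [K1] and [K4] are the room left on its two sides. *)
have [K1 [K2 [rK1 rK2 K1J2 K2J2 K12]]] := region_split rJ2.
have [K3 [K4 [rK3 rK4 K32 K42 K34]]] := region_split rK2.
have K3J2 := subset_trans K32 K2J2; have K3J := subset_trans K3J2 J2J.
have K3A A : F A -> A `&` K3 !=set0 -> J2 `<=` A.
  by move=> FA [x [Ax K3x]]; apply: sideJ2 => //; exists x; split=> //; exact: K3J2.
have end3 A B : F A -> (F `|` [set K3]) B -> A `<=` B -> F B.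
  by move=> FA [//|->] AK3; case: (nF _ FA); exact: subset_trans K3J.
have F'E : F `|` [set K3] = F.
  apply: maxF; last by split=> //; exact: subsetUl.
  split.
  - by move=> A [/Freg//|->].
  - move=> A B [FA|->] [FB|->]; last by left.
    + exact: Fnest.
    + by move=> /(K3A _ FA) J2A; right; exact: subset_trans J2A.
    + by rewrite setIC => /(K3A _ FB) J2B; left; exact: subset_trans J2B.
  - move=> K KF' [B KB]; have [[C [KC FC]]|nKF] := pselect (exists C, K C /\ F C).
    + have [||M [KM FM] maxM] := Fnoeth [set A | K A /\ F A].
      * by move=> ? [].
      * by exists C.
      * exists M => // A KA MA; apply: maxM => //; split=> //.
        exact: end3 (KF' _ KA) MA.
    + have K3E A : K A -> A = K3.
        by move=> KA; have [FA|//] := KF' _ KA; case: nKF; exists A.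
      by exists B => // A /K3E-> _; rewrite (K3E B).
  - move=> A B [FA|->] [FB|->] [BA nAB]; last by case: nAB.
    + exact: Fgap.
    + have J2A : J2 `<=` A.
        apply: K3A => //; have [_ [x K3x] _ _] := rK3.
        by exists x; split=> //; exact: BA.
      exists K1, K4; split=> //.
      * exact: subset_trans J2A.
      * exact: subset_trans (subset_trans K42 K2J2) J2A.
      * by split=> // x y K1x /K32; exact: K12.
    + by case: (nF _ FB); exact: subset_trans K3J.
by apply: (nF K3) => //; rewrite -F'E; right.
Qed.

Lemma isolated_countable : ccc X -> countable isolated.
Proof.
move=> cccX; apply: (countable_inj_image (f := set1)).
  by move=> x y _ _ /= xy; have : [set x] x by []; rewrite xy.
apply: cccX => [_ [x Ix <-]|_ _ [x _ <-] [y _ <-] [z [-> ->]]//].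
by split=> //; exists x.
Qed.

(** If the maximal forest were countable, one point from each member and the isolated points would
    form a countable dense set. *)
Lemma souslin_line_tree : souslin_line X -> exists T : set (set X), souslin_tree T.
Proof.
move=> [cccX nsepX]; have [T [hT maxT]] := forest_max.
have pibase J : region J -> exists2 A, T A & A `<=` J.
  exact: forest_pibase maxT.
have [Treg Tnest Tnoeth Tgap] := hT.
exists T; split=> //.
- by move=> A /Treg[].
- by move=> A /Treg[].
- move=> A B TA TB BA; have [L [R [rL rR LA RA [LB BR]]]] := Tgap _ _ TA TB BA.
  have [L' TL' LL'] := pibase _ rL; have [R' TR' RR'] := pibase _ rR.
  exists L', R'; split=> //; [exact: subset_trans LA|exact: subset_trans RA|].
  by split=> x y; [move=> /LL' Lx; exact: LB|move=> Bx /RR'; exact: BR].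
- move=> A TA; have [J1 [J2 [rJ1 rJ2 J1A J2A J12]]] := region_split (Treg _ TA).
  have [B TB BJ1] := pibase _ rJ1; exists B => //; split.
    exact: subset_trans J1A.
  move=> AB; have [_ [x J2x] _ _] := rJ2.
  by have := J12 _ _ (BJ1 _ (AB _ (J2A _ J2x))) J2x; rewrite ltxx.
- move=> K KT trivK; apply: cccX => // A /KT/Treg[openA A0 _ _].
  by split.
- move=> countT; apply: (nsepX).
  have /choice[p pP] A : exists x, T A -> A x.
    have [/Treg[_ [x Ax] _ _]|nTA] := pselect (T A); first by exists x.
    (* A default point exists, since an empty line is separable. *)
    have [x _] : [set: X] !=set0.
      apply: contrapT => X0; apply: nsepX; exists set0; split=> //.
      by move=> O [x _]; case: X0; exists x.
    by exists x.
  exists (isolated `|` p @` T)%classic; split.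
    rewrite -bigcup2E; apply: bigcup_countable => // -[|[|i]] _ /=.
    - exact: isolated_countable.
    - exact: sub_countable (card_image_le _ _) countT.
    - exact: countable0.
  move=> O [x Ox] openO; have [Ix|nIx] := pselect (closure isolated x).
    have [|y [Iy Oy]] := Ix O; first exact: open_nbhs_nbhs.
    by exists y; split=> //; left.
  have [J rJ [Jx JO]] := region_itv openO Ox nIx.
  have [A TA AJ] := pibase _ rJ.
  by exists (p A); split; [exact/JO/AJ/(pP _ TA)|right; exists A].
Qed.

End Forest.

Theorem mainTheorem8 :
  (exists (d : Order.disp_t) (X : orderTopologicalType d), souslin_line X) ->
  (exists (d : Order.disp_t) (X : orderTopologicalType d),
     souslin_line X /\ monotonically_countably_metacompact X) /\
  (exists (d : Order.disp_t) (X : orderTopologicalType d),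
     souslin_line X /\ ~ monotonically_countably_metacompact X).
Proof.
move=> [d [X /souslin_line_tree[T hT]]]; split.
- exists d, (branch_line hT).
  by split; [exact: branch_line_souslin|exact: branch_line_mcm].
- exists _, (doubled (branch_line hT)).
  by split; [exact: doubled_branch_line_souslin|exact: doubled_branch_line_not_mcm].
Qed.
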